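(* (i) Both $\mathbf{PT}^+$ and $\mathbf{FPT}$ characterize the set of all team properties (every team property is definable); in particular $\mathbf{PT}^+\equiv\mathbf{FPT}$ (same expressive power). (ii) $\mathbf{PT}$ characterizes the set of all team properties which contain the empty team. (iii) $\mathbf{PU}$ characterizes the set of all union closed team properties which contain the empty team. (iv) $\mathbf{PU}^+$ characterizes the set of all union closed team properties. (v) $\mathbf{PD}$ characterizes the set of all downward closed team properties which contain the empty team. (vi) $\mathbf{PD}^+$ characterizes the set of all downward closed team properties.
   Context: Valuations are functions $s:N\to\{0,1\}$ on a set $N$ of indices; a team on $N$ is a set of valuations; a team property is a set of teams. Atoms and semantics: $X\models p_i$ iff $s(i)=1$ for all $s\in X$; $X\models\neg p_i$ iff $s(i)=0$ for all $s\in X$; $X\models\bot$ iff $X=\emptyset$; $X\models\mathrm{NE}$ iff $X\neq\emptyset$; dependence atom $=\!(p_{i_1}\dots p_{i_k},p_j)$: any $s,s'\in X$ agreeing on $i_1,\dots,i_k$ agree on $j$; independence atom $p_{i_1}\dots p_{i_k}\perp p_{j_1}\dots p_{j_m}$: for all $s,s'\in X$ there is $s''\in X$ agreeing with $s$ on the $i$'s and with $s'$ on the $j$'s; inclusion atom $p_{i_1}\dots p_{i_k}\subseteq p_{j_1}\dots p_{j_k}$: for all $s\in X$ there is $s'\in X$ with $(s(i_1),\dots,s(i_k))=(s'(j_1),\dots,s'(j_k))$. Connectives: $X\models\phi\wedge\psi$ iff both; tensor $X\models\phi\otimes\psi$ iff $X=Y\cup Z$ with $Y\models\phi$, $Z\models\psi$;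 nonempty disjunction (written $\circledast$ here) $X\models\phi\circledast\psi$ iff $X=\emptyset$ or $X=Y\cup Z$ with $Y,Z$ nonempty, $Y\models\phi$, $Z\models\psi$; Boolean disjunction $X\models\phi\vee\psi$ iff $X\models\phi$ or $X\models\psi$; linear implication $X\models\phi\multimap\psi$ iff for every team $Y$ with $Y\models\phi$, $X\cup Y\models\psi$. Logics (by atoms; connectives): $\mathbf{PT}$: $p_i,\neg p_i,\bot$; $\wedge,\circledast,\vee$. $\mathbf{PT}^+$: $p_i,\neg p_i,\bot,\mathrm{NE}$; $\wedge,\otimes,\vee$. $\mathbf{PU}$: $p_i,\neg p_i,\bot$; $\wedge,\otimes,\circledast$. $\mathbf{PU}^+$: $p_i,\neg p_i,\bot,\mathrm{NE}$; $\wedge,\otimes,\circledast$. $\mathbf{PD}$: $p_i,\neg p_i,\bot$, dependence atoms; $\wedge,\otimes,\vee$. $\mathbf{PD}^+$: same atoms; $\wedge,\otimes,\vee,\multimap$. $\mathbf{FPT}$: $p_i,\neg p_i,\bot,\mathrm{NE}$, independence, dependence and inclusion atoms; $\wedge,\otimes,\circledast,\vee$. For a set $\mathbb{P}$ of team properties let $\mathbb{P}_N=\{\mathsf{P}\upharpoonright N:\mathsf{P}\in\mathbb{P}\}$, $\mathsf{P}\upharpoonright N=\{X\upharpoonright N:X\in\mathsf{P}\}$. A logic characterizes $\mathbb{P}$ if for each finite $N=\{i_1,\dots,i_n\}$, $\mathbb{P}_N=\{\{X\subseteq 2^N: X\models\phi\}:\phi(p_{i_1},\dots,p_{i_n})\text{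 a formula of the logic}\}$. A team property $\mathsf{P}$ is downward closed if $Y\subseteq X\in\mathsf{P}$ implies $Y\in\mathsf{P}$, and union closed if $\mathcal{X}\subseteq\mathsf{P}$ implies $\bigcup\mathcal{X}\in\mathsf{P}$. Two logics have the same expressive power if every formula of each is semantically equivalent to a formula of the other.
   Formalization: ''Union closed'' is taken over nonempty families only (with the empty family, (iv) fails for NE), and ''characterizes'' ranges over nonempty finite N (for N empty there are no variables and (ii), (iii), (v), (vi) fail). *)

(* Defs.v *)
From mathcomp Require Import all_boot finmap.
From mathcomp Require Import boolp classical_sets.

Set Implicit Arguments.
Unset Strict Implicit.
Unset Printing Implicit Defensive.

Local Open Scope fset_scope.
Local Open Scope classical_set_scope.

Definition valuation (V : Type) := V -> bool.
Definition team (V : Type) := set (valuation V).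
Definition team_property (V : Type) := set (team V).

(* A formula of [formula V] has its propositional variables among the p_i with
   i : V, and is evaluated on teams on V.  Taking V := N for a finite set N of
   indices gives the formulas phi(p_{i_1},...,p_{i_n}). *)
Inductive formula (V : Type) : Type :=
| Var of V
| NegVar of V
| Bot
| NE
| Dep of seq V & V
| Indep of seq V & seq V
| Incl (k : nat) of k.-tuple V & k.-tuple V
| And of formula V & formula V
| Tensor of formula V & formula V
| NeDisj of formula V & formula V
| BoolDisj of formula V & formula V
| LinImp of formula V & formula V.

Arguments Bot {V}.
Arguments NE {V}.

Fixpoint sat (V : Type) (X : team V) (f : formula V) : Prop :=
  match f with
  | Var i => forall s, X s -> s i = true
  | NegVar i => forall s, X s -> s i = false
  | Bot => X = set0
  | NE => X <> set0
  | Dep us j =>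
      forall s s', X s -> X s' -> map s us = map s' us -> s j = s' j
  | Indep us vs =>
      forall s s', X s -> X s' ->
        exists s'', [/\ X s'', map s'' us = map s us & map s'' vs = map s' vs]
  | Incl _ us vs =>
      forall s, X s -> exists s', X s' /\ map s us = map s' vs
  | And f g => sat X f /\ sat X g
  | Tensor f g => exists Y Z, [/\ X = Y `|` Z, sat Y f & sat Z g]
  | NeDisj f g =>
      X = set0 \/
      exists Y Z, [/\ X = Y `|` Z, Y <> set0, Z <> set0, sat Y f & sat Z g]
  | BoolDisj f g => sat X f \/ sat X g
  | LinImp f g => forall Y : team V, sat Y f -> sat (X `|` Y) g
  end.

(* A logic is given by the atoms and connectives it allows. *)
Inductive symbol : Type :=
| sVar | sNegVar | sBot | sNE | sDep | sIndep | sIncl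
| sAnd | sTensor | sNeDisj | sBoolDisj | sLinImp.

Definition logic := set symbol.

Fixpoint in_logic (V : Type) (L : logic) (f : formula V) : Prop :=
  match f with
  | Var _ => L sVar
  | NegVar _ => L sNegVar
  | Bot => L sBot
  | NE => L sNE
  | Dep _ _ => L sDep
  | Indep _ _ => L sIndep
  | Incl _ _ _ => L sIncl
  | And f g => [/\ L sAnd, in_logic L f & in_logic L g]
  | Tensor f g => [/\ L sTensor, in_logic L f & in_logic L g]
  | NeDisj f g => [/\ L sNeDisj, in_logic L f & in_logic L g]
  | BoolDisj f g => [/\ L sBoolDisj, in_logic L f & in_logic L g]
  | LinImp f g => [/\ L sLinImp, in_logic L f & in_logic L g]
  end.

Definition PT : logic :=
  [set sVar; sNegVar; sBot; sAnd; sNeDisj; sBoolDisj].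
Definition PTplus : logic :=
  [set sVar; sNegVar; sBot; sNE; sAnd; sTensor; sBoolDisj].
Definition PU : logic :=
  [set sVar; sNegVar; sBot; sAnd; sTensor; sNeDisj].
Definition PUplus : logic :=
  [set sVar; sNegVar; sBot; sNE; sAnd; sTensor; sNeDisj].
Definition PD : logic :=
  [set sVar; sNegVar; sBot; sDep; sAnd; sTensor; sBoolDisj].
Definition PDplus : logic :=
  [set sVar; sNegVar; sBot; sDep; sAnd; sTensor; sBoolDisj; sLinImp].
Definition FPT : logic :=
  [set sVar; sNegVar; sBot; sNE; sIndep; sDep; sIncl;
       sAnd; sTensor; sNeDisj; sBoolDisj].

Definition val_restr (I : choiceType) (N : {fset I}) (s : valuation I) :
  valuation N := fun i => s (fsval i).
Arguments val_restr {I} N s.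
Definition team_restr (I : choiceType) (N : {fset I}) (X : team I) : team N :=
  [set val_restr N s | s in X].
Arguments team_restr {I} N X.
Definition prop_restr (I : choiceType) (N : {fset I}) (P : team_property I) :
  team_property N := [set team_restr N X | X in P].
Arguments prop_restr {I} N P.

Definition defined_by (V : Type) (f : formula V) : team_property V :=
  [set X | sat X f].

(* N is nonempty: over the empty set there is no variable, and for instance the
   property "all teams" would not be definable in PT, PU, PD, PD+. *)
Definition characterizes (I : choiceType) (L : logic)
    (PP : set (team_property I)) : Prop :=
  forall N : {fset I}, N <> fset0 ->
    [set prop_restr N P | P in PP] =
    [set defined_by f | f in [set f : formula N | in_logic L f]].

Definition equivalent (V : Type) (f g : formula V) : Prop :=
  forall X : team V, sat X f <-> sat X g.

Definition same_expressive_power (I : Type) (L1 L2 : logic) : Prop :=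
  (forall f : formula I, in_logic L1 f ->
     exists g : formula I, in_logic L2 g /\ equivalent f g) /\
  (forall g : formula I, in_logic L2 g ->
     exists f : formula I, in_logic L1 f /\ equivalent g f).

Definition contains_empty (V : Type) (P : team_property V) : Prop := P set0.

Definition downward_closed (V : Type) (P : team_property V) : Prop :=
  forall X Y : team V, Y `<=` X -> P X -> P Y.

(* Only nonempty families: with the empty family, every union closed property
   would contain the empty team, and NE would not define such a property. *)
Definition union_closed (V : Type) (P : team_property V) : Prop :=
  forall F : set (team V), F `<=` P -> F !=set0 -> P (\bigcup_(X in F) X).

(* Main.v *)
(** Over a finite nonempty [N] there are finitely many valuations and teams.
    The conjunction of the literals true at [s] defines the subteams of [{s}].
    Combining these with the disjunctions of each logic defines, for a team [X],
    the property [{X}] (PT+), [{set0, X}] (PT, PU) or the subteams of [X] (PD);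
    a Boolean disjunction (PT, PT+, PD) or a tensor (PU) of such formulas over
    the members of a property then defines that property.  The constants
    [Bot /\ NE] and [p -o Bot] supply the empty property.  For [PT+ = FPT] over
    arbitrary indices, FPT formulas are local: satisfaction depends only on the
    restriction of the team to the finitely many variables that occur. *)
Require Import Defs.
From mathcomp Require Import all_boot finmap.
From mathcomp Require Import boolp classical_sets.

Set Implicit Arguments.
Unset Strict Implicit.
Unset Printing Implicit Defensive.

Local Open Scope classical_set_scope.

(** * Tactics deciding whether a symbol belongs to a logic *)

Ltac logic_in := by repeat first [exact: erefl | right; exact: erefl | left].

(** Unfolding the logic turns a false membership hypothesis into a disjunction of equations between
    distinct constructors. *)
Ltac logic_absurd :=
  exfalso; match goal with H : _ |- _ =>
    by move: H; rewrite ?/PT ?/PTplus ?/PU ?/PUplus ?/PD ?/PDplus ?/FPT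
      /setU /set1 /mkset /=; intuition discriminate
  end.

(** * Induction on teams and on team properties over finitely many indices *)

(** Finiteness of [T] is expressed by a surjection from a finite type, because valuations and teams
    are plain functions and predicates. The set [A] is built up along the enumeration of [F], one
    value of [g] at a time. *)
Lemma finite_image_set_ind (F : finType) (T : Type) (g : F -> T)
    (K : set T -> Prop) :
  (forall t, exists a, g a = t) -> K set0 ->
  (forall x A, K A -> K (x |` A)) -> forall A, K A.
Proof.
move=> gS K0 KS A.
have KE (l : seq F) : K [set t | exists a, [/\ a \in l, g a = t & A t]].
  elim: l => [|a l IH].
    suff -> : [set t | exists a, [/\ a \in [::], g a = t & A t]] = set0 by [].
    by apply/seteqP; split => // t [a []].
  have [Aa|nAa] := pselect (A (g a)).
    have -> : [set t | exists b, [/\ b \in a :: l, g b = t & A t]] =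
       g a |` [set t | exists b, [/\ b \in l, g b = t & A t]].
      apply/seteqP; split => t.
        move=> [b []]; rewrite inE => /orP[/eqP-> <- _|bl gb At].
          by left.
        by right; exists b.
      move=> [->|[b [bl gb At]]]; first by exists a; rewrite mem_head.
      by exists b; rewrite inE bl orbT.
    exact: KS.
  suff -> : [set t | exists b, [/\ b \in a :: l, g b = t & A t]] =
       [set t | exists b, [/\ b \in l, g b = t & A t]] by [].
  apply/seteqP; split => t [b []].
    by rewrite inE => /orP[/eqP-> <- /nAa//|bl gb At]; exists b.
  by move=> bl gb At; exists b; rewrite inE bl orbT.
suff -> : A = [set t | exists a, [/\ a \in enum F, g a = t & A t]] by [].
apply/seteqP; split => t; last by move=> [a []].
by move=> At; have [a ga] := gS t; exists a; rewrite mem_enum.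
Qed.

Lemma team_ind (V : finType) (K : team V -> Prop) :
  K set0 -> (forall s X, K X -> K (s |` X)) -> forall X, K X.
Proof.
apply: (@finite_image_set_ind {ffun V -> bool} _ (fun f => f : valuation V)).
by move=> s; exists [ffun i => s i]; apply/funext => i; rewrite ffunE.
Qed.

Lemma team_property_ind (V : finType) (K : team_property V -> Prop) :
  K set0 -> (forall X Q, K Q -> K (X |` Q)) -> forall Q, K Q.
Proof.
apply: (@finite_image_set_ind {set {ffun V -> bool}} _
  (fun A => [set s : valuation V | finfun s \in A])) => X.
(* The preimage of the team [X] among the finite functions. *)
exists [set f : {ffun V -> bool} | `[< X (f : V -> bool) >]]%SET.
apply/seteqP; split => s; rewrite /= inE /=.
  move=> /asboolP; congr X.
  by apply/funext => i; rewrite ffunE.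
move=> Xs; apply/asboolP; move: Xs; congr X.
by apply/funext => i; rewrite ffunE.
Qed.

(** * Definable team properties and their closure under the connectives *)

(** Working with properties instead of formulas lets definability be transported along equalities of
    sets. *)
Definition definable (V : Type) (L : logic) : set (team_property V) :=
  [set defined_by f | f in [set f : formula V | in_logic L f]].

Definition tensor_prop (V : Type) (P Q : team_property V) : team_property V :=
  [set X | exists Y Z, [/\ X = Y `|` Z, P Y & Q Z]].

Definition nedisj_prop (V : Type) (P Q : team_property V) : team_property V :=
  [set X | X = set0 \/
     exists Y Z, [/\ X = Y `|` Z, Y <> set0, Z <> set0, P Y & Q Z]].

Section Definability.
Variables (V : Type) (L : logic).
Implicit Types (P Q : team_property V).

Lemma definable_Bot : L sBot -> definable L [set (set0 : team V)].
Proof. by move=> h; exists Bot. Qed.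

Lemma definable_NE : L sNE -> definable L [set X : team V | X <> set0].
Proof. by move=> h; exists NE. Qed.

Lemma definable_And P Q :
  L sAnd -> definable L P -> definable L Q -> definable L (P `&` Q).
Proof. by move=> h [f fL <-] [g gL <-]; exists (And f g). Qed.

Lemma definable_BoolDisj P Q :
  L sBoolDisj -> definable L P -> definable L Q -> definable L (P `|` Q).
Proof. by move=> h [f fL <-] [g gL <-]; exists (BoolDisj f g). Qed.

Lemma definable_Tensor P Q :
  L sTensor -> definable L P -> definable L Q -> definable L (tensor_prop P Q).
Proof. by move=> h [f fL <-] [g gL <-]; exists (Tensor f g). Qed.

Lemma definable_NeDisj P Q :
  L sNeDisj -> definable L P -> definable L Q -> definable L (nedisj_prop P Q).
Proof. by move=> h [f fL <-] [g gL <-]; exists (NeDisj f g). Qed.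

End Definability.

(** * Expressive completeness over a finite index set *)

Section Completeness.
Variables (V : finType) (L : logic).
Hypotheses (LVar : L sVar) (LNegVar : L sNegVar) (LBot : L sBot) (LAnd : L sAnd).
Implicit Types (s : valuation V) (X Y : team V) (P Q : team_property V).

Lemma definable_literal s (i : V) :
  definable L [set X | forall t, X t -> t i = s i].
Proof.
by case si: (s i); [exists (Var i)|exists (NegVar i)].
Qed.

(** The conjunction of all literals true at [s] pins every member of the team to [s]. The property
    [P] stands in for the empty conjunction: it may be a literal when an index is at hand, or the
    full property where that is definable. *)
Lemma definable_subsets1_of P s :
  definable L P -> (forall X, X `<=` [set s] -> P X) ->
  definable L [set X | X `<=` [set s]].
Proof.
move=> dP sP.
have dl (l : seq V) : definable L
    (P `&` [set X | forall i, i \in l -> forall t, X t -> t i = s i]).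
  elim: l => [|i l IH].
    by rewrite (_ : [set _ | _] = setT) ?setIT//; apply/seteqP; split.
  have := definable_And LAnd (definable_literal s i) IH.
  congr (definable _); apply/seteqP; split => X /=.
    move=> [Xi [PX Xl]]; split=> // j; rewrite inE => /orP[/eqP->|] //.
    exact: Xl.
  move=> [PX Xl]; split; first by apply: Xl; rewrite mem_head.
  by split=> // j jl; apply: Xl; rewrite inE jl orbT.
have := dl (enum V); congr (definable _); apply/seteqP; split => X /=.
  move=> [_ H] t Xt; apply/funext => i.
  by apply: H => //; rewrite mem_enum.
by move=> Xs; split; [exact: sP|move=> i _ t /Xs ->].
Qed.

Lemma definable_subsets1 (i : V) s : definable L [set X | X `<=` [set s]].
Proof.
apply: definable_subsets1_of (definable_literal s i) _ => X Xs t.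
by move=> /Xs ->.
Qed.

(** The nonempty disjunction glues valuations together: its two parts, being nonempty, must be all
    of [[set s]] and all of [X]. *)
Lemma definable_set0_or (i : V) X : L sNeDisj -> definable L [set set0; X].
Proof.
move=> LNeDisj; elim/team_ind: X => [|s X IH].
  by rewrite setUid; apply: definable_Bot.
(* With [X] empty the second part could never be nonempty, so the singleton team is treated
   directly. *)
have [->|X0] := pselect (X = set0).
  have := definable_subsets1 i s; rewrite setU0; congr (definable _).
  apply/seteqP; split => Y /=; first exact: subset_set1.
  by move=> [] ->.
have := definable_NeDisj LNeDisj (definable_subsets1 i s) IH.
congr (definable _); apply/seteqP; split => Y /=.
  move=> [->|[A [B [-> A0 B0]]]]; first by left.
  by move=> /subset_set1[] // -> [] // ->; right.
move=> [->|->]; first by left.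
right; exists [set s], X; split=> //; last by right.
by apply/eqP/set0P; exists s.
Qed.

Lemma definable_contains_empty (i : V) Q :
  L sNeDisj -> L sBoolDisj -> contains_empty Q -> definable L Q.
Proof.
move=> LNeDisj LBoolDisj Q0.
(* Keeping [set0] in the property throughout makes [Bot] the base of the induction. *)
suff: definable L (set0 |` Q) by rewrite (setUidr _)// => _ ->.
elim/team_property_ind: {Q0} Q => [|X Q IH].
  by rewrite setU0; apply: definable_Bot.
have := definable_BoolDisj LBoolDisj (definable_set0_or i X LNeDisj) IH.
by rewrite setUACA setUid.
Qed.

(** A tensor of the properties [[set set0; X]] lets each [X] be either used or skipped, hence
    defines the unions of subfamilies of [Q]; union closure identifies these with the members of
    [Q]. *)
Lemma definable_union_closed_set0 (i : V) Q :
  L sNeDisj -> L sTensor -> union_closed Q -> contains_empty Q -> definable L Q.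
Proof.
move=> LNeDisj LTensor QU Q0.
have: definable L [set X | exists2 B, B `<=` Q & X = \bigcup_(Y in B) Y].
  elim/team_property_ind: {QU Q0} Q => [|X Q IH].
    have := definable_Bot V LBot; congr (definable _).
    apply/seteqP; split => X /=.
      by move=> ->; exists set0 => //; rewrite bigcup_set0.
    by move=> [B]; rewrite subset0 => ->; rewrite bigcup_set0.
  have := definable_Tensor LTensor (definable_set0_or i X LNeDisj) IH.
  congr (definable _); apply/seteqP; split => Y /=.
    move=> [A [_ [-> A0 [B BQ ->]]]]; case: A0 => ->.
      exists B; first by move=> Z /BQ; right.
      by rewrite set0U.
    exists (X |` B); last by rewrite bigcup_setU1.
    by move=> Z [->|/BQ]; [left|right].
  move=> [B BQ ->].
  (* [X] goes to the first factor exactly when [B] uses it; the rest of [B] lies in [Q]. A repeated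
     [X] in the second part does not change the union. *)
  exists (if pselect (B X) then X else set0), (\bigcup_(Z in B `&` Q) Z).
  split.
  - apply/seteqP; split => s.
      move=> [Z BZ Zs]; case: (BQ _ BZ) => [ZX|QZ].
        by left; case: pselect => /=; rewrite -ZX.
      by right; exists Z.
    by move=> [|[Z [BZ QZ] Zs]]; [case: pselect => //= BX Xs; exists X|exists Z].
  - by case: pselect => BX /=; [right|left].
  - by exists (B `&` Q) => // Z [].
congr (definable _); apply/seteqP; split => X /=.
  move=> [B BQ ->].
  (* Union closure speaks of nonempty families only, and [B] may be empty; adding [set0] to [B]
     leaves the union unchanged. *)
  rewrite -(set0U (\bigcup_(_ in _) _)) -(bigcup_setU1 id set0 B).
  by apply: QU; [move=> Z [->|/BQ]|exists set0; left].
by move=> QX; exists [set X]; rewrite ?bigcup_set1// => Z ->.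
Qed.

(** A subteam of the union splits into its intersections with [[set s]] and with [X], which is what
    the tensor asks for. *)
Lemma definable_subsets (i : V) X :
  L sTensor -> definable L [set Y | Y `<=` X].
Proof.
move=> LTensor; elim/team_ind: X => [|s X IH].
  have := definable_Bot V LBot; congr (definable _).
  by apply/seteqP; split => Y; rewrite /= subset0.
have := definable_Tensor LTensor (definable_subsets1 i s) IH.
congr (definable _); apply/seteqP; split => Y /=.
  by move=> [A [B [-> As BX]]]; apply: setUSS.
move=> Ys; exists (Y `&` [set s]), (Y `&` X); split.
- by rewrite -setIUr; apply/esym/setIidPl.
- exact: subIsetr.
- exact: subIsetr.
Qed.

Lemma definable_downward_closed_set0 (i : V) Q :
  L sTensor -> L sBoolDisj -> downward_closed Q -> contains_empty Q ->
  definable L Q.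
Proof.
move=> LTensor LBoolDisj Qd Q0.
(* This is the downward closure of [Q] together with the empty team, which makes it definable by
   [Bot] when [Q] is empty. *)
have: definable L [set X | X = set0 \/ exists2 Y, Q Y & X `<=` Y].
  elim/team_property_ind: {Qd Q0} Q => [|X Q IH].
    have := definable_Bot V LBot; congr (definable _).
    apply/seteqP; split => X /=; first by left.
    by case=> // -[].
  have := definable_BoolDisj LBoolDisj (definable_subsets i X LTensor) IH.
  congr (definable _); apply/seteqP; split => Y /=.
    move=> [YX|[->|[Z QZ YZ]]]; [|by left|].
      by right; exists X => //; left.
    by right; exists Z => //; right.
  move=> [->|[Z [->|QZ]] YZ]; [by left|by left|].
  by right; right; exists Z.
congr (definable _); apply/seteqP; split => X /=.
  by move=> [->//|[Y QY XY]]; apply: Qd QY.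
by move=> QX; right; exists X.
Qed.

Lemma definable_empty : L sNE -> definable L (set0 : team_property V).
Proof.
move=> LNE.
have := definable_And LAnd (definable_Bot V LBot) (definable_NE V LNE).
by congr (definable _); apply/seteqP; split => X //= -[].
Qed.

(** The full property is [Bot] or [NE], so no variable is required and an empty [V] is covered as
    well. *)
Lemma definable_all Q : L sNE -> L sTensor -> L sBoolDisj -> definable L Q.
Proof.
move=> LNE LTensor LBoolDisj.
have dNE := definable_NE V LNE.
have dT : definable L [set: team V].
  have := definable_BoolDisj LBoolDisj (definable_Bot V LBot) dNE.
  by congr (definable _); apply/seteqP; split => X //= _; exact: EM.
have d1 X : definable L [set X].
  elim/team_ind: X => [|s X IH]; first exact: definable_Bot.
  (* [NE] cuts the subteams of [[set s]] down to [[set s]] itself, so the tensor with [[set X]]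
     leaves a single team. *)
  have ds := definable_And LAnd dNE (@definable_subsets1_of _ s dT (fun _ _ => I)).
  have := definable_Tensor LTensor ds IH.
  congr (definable _); apply/seteqP; split => Y /=.
    by move=> [A [B [-> [A0]]]] /subset_set1[] // -> ->.
  move=> ->; exists [set s], X; split=> //; split=> //.
  by apply/eqP/set0P; exists s.
elim/team_property_ind: Q => [|X Q IH]; first exact: definable_empty.
exact: definable_BoolDisj.
Qed.

(** If [Q] lacks the empty team, add it, define the result without [NE], and remove it again by a
    conjunction with [NE]. *)
Lemma definable_union_closed (i : V) Q :
  L sNE -> L sNeDisj -> L sTensor -> union_closed Q -> definable L Q.
Proof.
move=> LNE LNeDisj LTensor QU.
have [Q0|nQ0] := pselect (Q set0); first exact: definable_union_closed_set0.
have dQ : definable L (set0 |` Q).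
  apply: definable_union_closed_set0 => //; last by left.
  move=> F FQ F0.
  (* If [F] meets [Q], dropping the empty team from [F] keeps both its union and its nonemptiness;
     otherwise every member of [F] is empty. *)
  have [[X [FX QX]]|FnQ] := pselect (exists X, F X /\ Q X).
    right; have -> : \bigcup_(Y in F) Y = \bigcup_(Y in F `&` Q) Y.
      apply/seteqP; split => s [Y]; last by move=> [FY _] Ys; exists Y.
      by move=> FY Ys; exists Y => //; split=> //; case: (FQ _ FY) Ys => // ->.
    by apply: QU; [move=> Y []|exists X].
  left; apply: bigcup0 => Y FY; case: (FQ _ FY) => // QY.
  by case: FnQ; exists Y.
have := definable_And LAnd (definable_NE V LNE) dQ.
congr (definable _); apply/seteqP; split => X /=.
  by move=> [X0 [/X0|]].
by move=> QX; split; [move=> X0; apply: nQ0; rewrite -X0|right].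
Qed.

Lemma definable_downward_closed (i : V) Q :
  L sTensor -> L sBoolDisj -> L sLinImp -> downward_closed Q -> definable L Q.
Proof.
move=> LTensor LBoolDisj LLinImp Qd.
have [[X QX]|nQ] := pselect (exists X, Q X).
  by apply: definable_downward_closed_set0 => //; apply: Qd QX.
exists (LinImp (Var i) Bot) => //; apply/seteqP; split => X /=.
  (* The team of the constantly true valuation satisfies [Var i], and its union with [X] is
     nonempty, so [Bot] fails there. *)
  move=> /(_ [set fun=> true]) XT.
  have : (X `|` [set fun=> true]) (fun=> true) by right.
  by rewrite XT// => s ->.
by move=> QX; case: nQ; exists X.
Qed.

End Completeness.

(** * Closure properties forced by the symbols of a logic *)

Lemma sat_set0 (V : Type) (L : logic) (f : formula V) :
  ~ L sNE -> ~ L sLinImp -> in_logic L f -> sat set0 f.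
Proof.
move=> LNE LLinImp.
elim: f => //= [f IHf g IHg|f IHf g IHg|f _ g _|f IHf g IHg|f _ g _] [LS fL gL].
- by split; auto.
- by exists set0, set0; rewrite setU0; split; auto.
- by left.
- by left; auto.
- by [].
Qed.

Lemma union_closed_defined_by (V : Type) (L : logic) (f : formula V) :
  ~ L sDep -> ~ L sIndep -> ~ L sBoolDisj -> in_logic L f ->
  union_closed (defined_by f).
Proof.
move=> LDep LIndep LBoolDisj.
elim: f => [i|i|||us j|us vs|k us vs|f IHf g IHg|f IHf g IHg|f IHf g IHg
  |f IHf g IHg|f IHf g IHg] //= fL F FP F0; rewrite /defined_by /=.
- by move=> s [X FX]; apply: (FP X FX).
- by move=> s [X FX]; apply: (FP X FX).
- by apply: bigcup0 => X FX; apply: (FP X FX).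
- move=> U0; have [X FX] := F0; apply: (FP X FX).
  by rewrite -subset0 -U0; apply: bigcup_sup.
- move=> s [X FX Xs]; have [t [Xt e]] := FP X FX s Xs.
  by exists t; split=> //; exists X.
- by case: fL => _ fL gL; split; [apply: IHf|apply: IHg] => // X /FP [].
- case: fL => _ fL gL.
  (* Collecting all subteams of members of [F] that satisfy [f], and likewise for [g], avoids
     choosing a decomposition for each member. *)
  exists (\bigcup_(Y in [set Y | sat Y f /\ exists2 X, F X & Y `<=` X]) Y).
  exists (\bigcup_(Y in [set Y | sat Y g /\ exists2 X, F X & Y `<=` X]) Y).
  split.
  + apply/seteqP; split => s.
      move=> [X FX]; have [Y [Z [XE Yf Zg]]] := FP X FX.
      rewrite XE => -[Ys|Zs]; [left; exists Y|right; exists Z] => //; split=> //;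
      by exists X => //; rewrite XE => t ?; first [by left|by right].
    by move=> [|] [Y [_ [X FX YX]] /YX Xs]; exists X.
  + apply: IHf => //; first by move=> Y [].
    have [X FX] := F0; have [Y [Z [XE Yf Zg]]] := FP X FX.
    by exists Y; split=> //; exists X => //; rewrite XE => t; left.
  + apply: IHg => //; first by move=> Y [].
    have [X FX] := F0; have [Y [Z [XE Yf Zg]]] := FP X FX.
    by exists Z; split=> //; exists X => //; rewrite XE => t; right.
- case: fL => _ fL gL.
  (* A nonempty union has a nonempty member, whose decomposition shows that both collected parts are
     nonempty. *)
  have [U0|U0] := pselect (\bigcup_(X in F) X = set0); [by left|right].
  have [X0 FX0 X0N] : exists2 X, F X & X <> set0.
    apply: contrapT => nX; apply: U0; apply: bigcup0 => X FX.
    by apply: contrapT => XN; apply: nX; exists X.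
  have {}FP X : F X -> X <> set0 -> exists Y Z,
      [/\ X = Y `|` Z, Y <> set0, Z <> set0, sat Y f & sat Z g].
    by move=> /FP [].
  have [Y0 [Z0 [X0E Y0N Z0N Y0f Z0g]]] := FP _ FX0 X0N.
  pose A h := [set Y : team V | sat Y h /\ exists2 X, F X & Y `<=` X].
  have AY0 : A f Y0 by split=> //; exists X0 => //; rewrite X0E => t; left.
  have AZ0 : A g Z0 by split=> //; exists X0 => //; rewrite X0E => t; right.
  exists (\bigcup_(Y in A f) Y), (\bigcup_(Y in A g) Y).
  split.
  + apply/seteqP; split => s.
      move=> [X FX Xs]; have XN : X <> set0 by move=> XN; rewrite XN in Xs.
      have [Y [Z [XE _ _ Yf Zg]]] := FP X FX XN; move: Xs.
      rewrite XE => -[Ys|Zs]; [left; exists Y|right; exists Z] => //; split=> //;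
      by exists X => //; rewrite XE => t ?; first [by left|by right].
    by move=> [|] [Y [_ [X FX YX]] /YX Xs]; exists X.
  + move=> A0; apply: Y0N; rewrite -subset0 -A0; exact: bigcup_sup.
  + move=> A0; apply: Z0N; rewrite -subset0 -A0; exact: bigcup_sup.
  + by apply: IHf => //; [move=> Y []|exists Y0].
  + by apply: IHg => //; [move=> Y []|exists Z0].
- by case: fL.
- case: fL => _ fL gL Y Yf.
  have [X0 FX0] := F0.
  (* Adding [Y] commutes with the union because [F] is nonempty: [X0] carries the valuations of
     [Y]. *)
  suff -> : \bigcup_(X in F) X `|` Y =
      \bigcup_(Z in [set X `|` Y | X in F]) Z.
    apply: IHg => //; last by exists (X0 `|` Y), X0.
    by move=> _ [X FX <-]; apply: (FP X FX).
  apply/seteqP; split => s.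
    move=> [[X FX Xs]|Ys].
      by exists (X `|` Y); [exists X|left].
    by exists (X0 `|` Y); [exists X0|right].
  by move=> [_ [X FX <-] [Xs|Ys]]; [left; exists X|right].
Qed.

Lemma downward_closed_defined_by (V : Type) (L : logic) (f : formula V) :
  ~ L sNE -> ~ L sIndep -> ~ L sIncl -> ~ L sNeDisj -> in_logic L f ->
  downward_closed (defined_by f).
Proof.
move=> LNE LIndep LIncl LNeDisj.
elim: f => [i|i|||us j|us vs|k us vs|f IHf g IHg|f IHf g IHg|f IHf g IHg
  |f IHf g IHg|f IHf g IHg] //= fL X Y YX; rewrite /defined_by /=.
- by move=> Xi s /YX; apply: Xi.
- by move=> Xi s /YX; apply: Xi.
- by move=> X0; rewrite -subset0 -X0.
- by move=> Xd s t /YX Xs /YX; apply: Xd.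
- by case: fL => _ fL gL [Xf Xg]; split; [apply: IHf Xf|apply: IHg Xg].
- case: fL => _ fL gL [A [B [XE Af Bg]]]; exists (Y `&` A), (Y `&` B); split.
  + by rewrite -setIUr -XE; apply/esym/setIidPl.
  + by apply: IHf Af => //; apply: subIsetr.
  + by apply: IHg Bg => //; apply: subIsetr.
- by case: fL.
- by case: fL => _ fL gL [Xf|Xg]; [left; apply: IHf Xf|right; apply: IHg Xg].
(* The added team [Z] is kept fixed, so only the consequent has to be downward closed. *)
- case: fL => _ fL gL H Z Zf; apply: IHg (H Z Zf) => //.
  exact: setSU.
Qed.

(** * Restricting properties to a finite index set and lifting them back *)

Section Restriction.
Variables (I : choiceType) (N : {fset I}).

Lemma team_restr_surj (X : team N) :
  team_restr N [set s | X (val_restr N s)] = X.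
Proof.
apply/seteqP; split => [_ [s Xs <-]//|s Xs].
(* Extends a valuation on [N] to all of [I], with default value [false] outside [N]. *)
pose t (i : I) := if insub i is Some j then s j else false.
have ts : val_restr N t = s by apply/funext => j; rewrite /val_restr /t valK.
by exists t; rewrite /= ts.
Qed.

Lemma team_restr0 : team_restr N set0 = set0.
Proof. exact: image_set0. Qed.

Lemma team_restr_bigcup (F : set (team I)) :
  team_restr N (\bigcup_(X in F) X) = \bigcup_(X in F) team_restr N X.
Proof. exact: image_bigcup. Qed.

Lemma team_restr_sub (X Y : team I) :
  X `<=` Y -> team_restr N X `<=` team_restr N Y.
Proof. exact: image_subset. Qed.

(** The largest property on [I] whose restriction to [N] is [Q]. *)
Definition prop_lift (Q : team_property N) : team_property I :=
  [set X | Q (team_restr N X)].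

Lemma prop_liftK : cancel prop_lift (prop_restr N).
Proof.
move=> Q; apply/seteqP; split => [_ [X QX <-]//|X QX].
by exists [set s | X (val_restr N s)]; rewrite /prop_lift /= team_restr_surj.
Qed.

Lemma contains_empty_restr (P : team_property I) :
  contains_empty P -> contains_empty (prop_restr N P).
Proof. by move=> P0; exists set0 => //; rewrite team_restr0. Qed.

Lemma contains_empty_lift (Q : team_property N) :
  contains_empty Q -> contains_empty (prop_lift Q).
Proof. by rewrite /contains_empty /prop_lift /= team_restr0. Qed.

Lemma union_closed_restr (P : team_property I) :
  union_closed P -> union_closed (prop_restr N P).
Proof.
move=> PU F FP [X0 FX0].
(* Taking every member of [P] that restricts into [F] avoids choosing one preimage per team. *)
exists (\bigcup_(X in P `&` prop_lift F) X).
  apply: PU; first by move=> X [].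
  by have [X PX XE] := FP _ FX0; exists X; rewrite /prop_lift /= XE.
rewrite team_restr_bigcup; apply/seteqP; split => s.
  by move=> [X [PX FX] Xs]; exists (team_restr N X).
move=> [Y FY Ys]; have [X PX XE] := FP _ FY.
by exists X; [split=> //; rewrite /prop_lift /= XE|rewrite XE].
Qed.

Lemma union_closed_lift (Q : team_property N) :
  union_closed Q -> union_closed (prop_lift Q).
Proof.
move=> QU F FQ [X0 FX0]; rewrite /prop_lift /= team_restr_bigcup.
rewrite (_ : \bigcup_(X in F) team_restr N X =
  \bigcup_(Y in team_restr N @` F) Y); last by rewrite bigcup_image.
by apply: QU; [move=> _ [X FX <-]; exact: FQ|exists (team_restr N X0), X0].
Qed.

Lemma downward_closed_restr (P : team_property I) :
  downward_closed P -> downward_closed (prop_restr N P).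
Proof.
move=> Pd Z Y YZ [X PX XZ]; rewrite -XZ in YZ.
exists (X `&` [set s | Y (val_restr N s)]); first by apply: Pd PX; apply: subIsetl.
apply/seteqP; split => [_ [s [_ Ys] <-]//|t Yt].
by have [s Xs sE] := YZ _ Yt; exists s => //; split=> //=; rewrite sE.
Qed.

Lemma downward_closed_lift (Q : team_property N) :
  downward_closed Q -> downward_closed (prop_lift Q).
Proof. by move=> Qd X Y YX; apply: Qd; apply: team_restr_sub. Qed.

End Restriction.

(** * From soundness and completeness to characterization *)

(** The class [C] is given uniformly in the index type, so that it can be moved between [I] and [N].
    Restriction and completeness give one inclusion; soundness and lifting give the other. *)
Lemma characterizes_intro (I : choiceType) (L : logic)
    (C : forall V : Type, set (team_property V)) :
  (forall (N : {fset I}) P, C I P -> C N (prop_restr N P)) ->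
  (forall (N : {fset I}) Q, C N Q -> C I (prop_lift Q)) ->
  (forall (V : finType) (f : formula V), in_logic L f -> C V (defined_by f)) ->
  (forall (V : finType) (i : V) Q, C V Q -> definable L Q) ->
  characterizes L (C I).
Proof.
move=> CR CL LC CD N N0; apply/seteqP; split.
  move=> _ [P CP <-].
  (* Nonemptiness of [N] supplies the index that the completeness lemmas ask for. *)
  have [E|[i iN]] := fset_0Vmem N; first by case: N0.
  by apply: (CD _ [` iN]%fset); apply: CR.
move=> _ [f fL <-]; exists (prop_lift (defined_by f)); last exact: prop_liftK.
by apply: CL; apply: LC.
Qed.

Lemma in_logic_sub (V : Type) (L L' : logic) (f : formula V) :
  L `<=` L' -> in_logic L f -> in_logic L' f.
Proof.
move=> LL'.
by elim: f => /= *; try exact: LL';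
  match goal with H : [/\ _, _ & _] |- _ => case: H => * end; split; auto.
Qed.

(** * Locality, and transfer of definability from [N] to [I] *)

Fixpoint vars (V : Type) (f : formula V) : seq V :=
  match f with
  | Var i | NegVar i => [:: i]
  | Bot | NE => [::]
  | Dep us j => rcons us j
  | Indep us vs => us ++ vs
  | Incl _ us vs => us ++ vs
  | And f g | Tensor f g | NeDisj f g | BoolDisj f g | LinImp f g =>
      vars f ++ vars g
  end.

Section Locality.
Variables (I : choiceType) (N : {fset I}).
Implicit Types (X Y : team I).

Lemma val_restr_eq (s t : valuation I) :
  val_restr N s = val_restr N t -> {in N, s =1 t}.
Proof. by move=> st i iN; apply: (congr1 (@^~ [` iN]%fset) st). Qed.

(** Each part of [Y] consists of the valuations whose restriction occurs in the corresponding part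
    of [X]. This carries both disjunctions through the locality proof. *)
Lemma team_restr_splitU X Y A B :
  team_restr N X = team_restr N Y -> X = A `|` B ->
  exists A' B', [/\ Y = A' `|` B', team_restr N A = team_restr N A' &
                    team_restr N B = team_restr N B'].
Proof.
move=> XY XE.
have part C : C `<=` X -> team_restr N C =
    team_restr N (Y `&` [set s | team_restr N C (val_restr N s)]).
  move=> CX; apply/seteqP; split; last by move=> _ [s [_ Cs] <-].
  move=> _ [s Cs <-]; have : team_restr N Y (val_restr N s).
    by rewrite -XY; exists s => //; apply: CX.
  by move=> [t Yt ts]; exists t => //; split=> //=; rewrite ts; exists s.
exists (Y `&` [set s | team_restr N A (val_restr N s)]).
exists (Y `&` [set s | team_restr N B (val_restr N s)]).
split; [|by apply: part; rewrite XE; left|by apply: part; rewrite XE; right].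
apply/seteqP; split => [s Ys|s [] []//].
have : team_restr N X (val_restr N s) by rewrite XY; exists s.
by move=> [t]; rewrite {1}XE => -[At|Bt] ts; [left|right]; split=> //; exists t.
Qed.

Lemma team_restr_eq0 X : team_restr N X = set0 -> X = set0.
Proof.
move=> X0; rewrite -subset0 => s Xs.
by have : team_restr N X (val_restr N s) by [exists s]; rewrite X0.
Qed.

(** One implication suffices, the assumption on [X] and [Y] being symmetric. Members of one team
    have counterparts in the other that agree on [N], hence on every variable of the formula. *)
Lemma sat_local (L : logic) (f : formula I) X Y :
  ~ L sLinImp -> in_logic L f -> {subset vars f <= N} ->
  team_restr N X = team_restr N Y -> sat X f -> sat Y f.
Proof.
move=> LLinImp.
have ex X1 Y1 s : team_restr N X1 = team_restr N Y1 -> Y1 s ->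
    exists2 t, X1 t & {in N, t =1 s}.
  move=> XY Ys; have : team_restr N X1 (val_restr N s) by rewrite XY; exists s.
  by move=> [t Xt /val_restr_eq]; exists t.
have eqm (us : seq I) (s t : valuation I) :
    {subset us <= N} -> {in N, s =1 t} -> map s us = map t us.
  by move=> usN st; apply/eq_in_map => i /usN /st.
have ne X1 Y1 : team_restr N X1 = team_restr N Y1 -> X1 <> set0 -> Y1 <> set0.
  by move=> XY X0 Y0; apply/X0/team_restr_eq0; rewrite XY Y0 team_restr0.
have subl (us vs : seq I) : {subset us ++ vs <= N} -> {subset us <= N}.
  by move=> H i iu; apply: H; rewrite mem_cat iu.
have subr (us vs : seq I) : {subset us ++ vs <= N} -> {subset vs <= N}.
  by move=> H i iu; apply: H; rewrite mem_cat iu orbT.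
elim: f X Y => [i|i|||us j|us vs|k us vs|f IHf g IHg|f IHf g IHg|f IHf g IHg
  |f IHf g IHg|f IHf g IHg] X Y //= fL fN XY.
- by move=> Xi s /(ex _ _ _ XY)[t Xt <-]; [apply: Xi|apply: fN; rewrite inE].
- by move=> Xi s /(ex _ _ _ XY)[t Xt <-]; [apply: Xi|apply: fN; rewrite inE].
- by move=> X0; apply: team_restr_eq0; rewrite -XY X0 team_restr0.
- exact: ne XY.
- move=> Xd s s' /(ex _ _ _ XY)[t Xt ts] /(ex _ _ _ XY)[t' Xt' ts'].
  have jN : j \in N by apply: fN; rewrite mem_rcons mem_head.
  have usN : {subset us <= N}.
    by move=> i iu; apply: fN; rewrite mem_rcons inE iu orbT.
  rewrite -(eqm _ _ _ usN ts) -(eqm _ _ _ usN ts') -ts// -ts'//.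
  exact: Xd.
- have usN := subl _ _ fN; have vsN := subr _ _ fN.
  move=> Xi s s' /(ex _ _ _ XY)[t Xt ts] /(ex _ _ _ XY)[t' Xt' ts'].
  have [t'' [Xt'' tu tv]] := Xi _ _ Xt Xt'.
  (* The witness found in [X] is carried back to [Y]. *)
  have [s'' Ys'' st''] := ex _ _ _ (esym XY) Xt''.
  exists s''; split=> //.
    by rewrite (eqm _ _ _ usN st'') tu; apply: eqm.
  by rewrite (eqm _ _ _ vsN st'') tv; apply: eqm.
- have usN := subl _ _ fN; have vsN := subr _ _ fN.
  move=> Xi s /(ex _ _ _ XY)[t Xt ts]; have [t' [Xt' tu]] := Xi _ Xt.
  have [s' Ys' st'] := ex _ _ _ (esym XY) Xt'.
  exists s'; split=> //.
  by rewrite (eqm _ _ _ vsN st') -tu; apply/esym/eqm.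
- case: fL => _ fL gL [Xf Xg].
  by split; [apply: IHf Xf|apply: IHg Xg] => //; [apply: subl fN|apply: subr fN].
- case: fL => _ fL gL [A [B [XE Af Bg]]].
  have [A' [B' [YE AA' BB']]] := team_restr_splitU XY XE.
  exists A', B'; split=> //.
    by apply: IHf Af => //; apply: subl fN.
  by apply: IHg Bg => //; apply: subr fN.
- case: fL => _ fL gL [X0|[A [B [XE A0 B0 Af Bg]]]].
    by left; apply: team_restr_eq0; rewrite -XY X0 team_restr0.
  have [A' [B' [YE AA' BB']]] := team_restr_splitU XY XE.
  right; exists A', B'; split=> //; [exact: ne A0|exact: ne B0| |].
    by apply: IHf Af => //; apply: subl fN.
  by apply: IHg Bg => //; apply: subr fN.
- case: fL => _ fL gL [Xf|Xg].
    by left; apply: IHf Xf => //; apply: subl fN.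
  by right; apply: IHg Xg => //; apply: subr fN.
- by case: fL.
Qed.

(** A splitting of the restricted team pulls back along restriction to a splitting of [X];
    conversely, restriction preserves unions. *)
Lemma prop_lift_tensor (P Q : team_property N) :
  prop_lift (tensor_prop P Q) = tensor_prop (prop_lift P) (prop_lift Q).
Proof.
apply/seteqP; split => X; rewrite /prop_lift /tensor_prop /=; last first.
  move=> [A [B [-> PA QB]]]; exists (team_restr N A), (team_restr N B).
  by split=> //; apply: image_setU.
move=> [A [B [XE PA QB]]].
have part (C : team N) : C `<=` team_restr N X ->
    team_restr N (X `&` [set s | C (val_restr N s)]) = C.
  move=> CX; apply/seteqP; split => [_ [s [_ Cs] <-]//|t Ct].
  by have [s Xs st] := CX _ Ct; exists s => //; split=> //=; rewrite st.
exists (X `&` [set s | A (val_restr N s)]), (X `&` [set s | B (val_restr N s)]).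
rewrite !part ?XE; [|by right|by left].
split=> //; apply/seteqP; split => [s Xs|s [] []//].
have : team_restr N X (val_restr N s) by exists s.
by rewrite XE => -[]; [left|right].
Qed.

(** Renaming variables along [fsval] turns a formula on [N] into one on [I] that defines the lifted
    property, because lifting commutes with each construct of [PTplus]. *)
Lemma definable_prop_lift (Q : team_property N) :
  definable PTplus Q -> definable PTplus (prop_lift Q).
Proof.
move=> [f fL <-].
have lit (i : N) b : [set X : team I | forall s, X s -> s (fsval i) = b] =
    prop_lift [set X : team N | forall s, X s -> s i = b].
  apply/seteqP; split => X Xi s; first by move=> [t Xt <-]; apply: Xi.
  by move=> Xs; apply: (Xi (val_restr N s)); exists s.
(* Restriction neither creates nor destroys emptiness, which settles [Bot] and [NE]. *)
have eq0 X : X = set0 <-> team_restr N X = set0.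
  by split=> [->|/team_restr_eq0//]; rewrite team_restr0.
elim: f fL => [i|i|||us j|us vs|k us vs|f IHf g IHg|f IHf g IHg|f _ g _
  |f IHf g IHg|f _ g _] fL; try by case: fL => *; logic_absurd.
- by exists (Var (fsval i)); [logic_in|exact: lit].
- by exists (NegVar (fsval i)); [logic_in|exact: lit].
- by exists Bot; [logic_in|apply/seteqP; split => X /eq0].
- exists NE; first by logic_in.
  by apply/seteqP; split => X X0 /eq0.
- case: fL => _ /IHf fd /IHg gd.
  by apply: (definable_And _ fd gd); logic_in.
- case: fL => _ /IHf fd /IHg gd.
  rewrite (_ : defined_by _ = tensor_prop (defined_by f) (defined_by g))//.
  by rewrite prop_lift_tensor; apply: definable_Tensor => //; logic_in.
- case: fL => _ /IHf fd /IHg gd.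
  by apply: (definable_BoolDisj _ fd gd); logic_in.
Qed.

End Locality.

(** * Equal expressive power of [PTplus] and [FPT], and the six characterizations *)

Lemma PTplus_sub_FPT : PTplus `<=` FPT.
Proof. by case=> H; first [logic_in | logic_absurd]. Qed.

Lemma PTplus_definable (V : finType) (Q : team_property V) : definable PTplus Q.
Proof. by apply: definable_all; logic_in. Qed.

(** Restrict the property of [g] to its finitely many variables, define it there in [PTplus], and
    lift; by locality the lifted property is again that of [g]. If [g] has no variables, [N] is
    empty, which [PTplus_definable] covers. *)
Lemma FPT_equiv_PTplus (I : choiceType) (g : formula I) :
  in_logic FPT g -> exists f, in_logic PTplus f /\ equivalent g f.
Proof.
move=> gL; pose N : {fset I} := [fset i in vars g]%fset.
have [f fL fE] :=
  definable_prop_lift (PTplus_definable (prop_restr N (defined_by g))).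
exists f; split=> // X.
have -> : sat X f = prop_lift (prop_restr N (defined_by g)) X by rewrite -fE.
split=> [Xg|[Y Yg YX]]; first by exists X.
have FPTl : ~ FPT sLinImp by move=> *; logic_absurd.
apply: (sat_local FPTl gL _ YX Yg).
by move=> i ig; rewrite in_fset.
Qed.

Theorem theorem3p4 (I : choiceType) :
  (characterizes PTplus [set: team_property I] /\
   characterizes FPT [set: team_property I] /\
   same_expressive_power I PTplus FPT) /\
  characterizes PT [set P : team_property I | contains_empty P] /\
  characterizes PU
    [set P : team_property I | union_closed P /\ contains_empty P] /\
  characterizes PUplus [set P : team_property I | union_closed P] /\
  characterizes PD
    [set P : team_property I | downward_closed P /\ contains_empty P] /\
  characterizes PDplus [set P : team_property I | downward_closed P].
Proof.
split; [split; [|split]|do 4 ?[split]].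
- apply: (characterizes_intro (C := fun V => setT)) => // V _ Q _.
  exact: PTplus_definable.
- apply: (characterizes_intro (C := fun V => setT)) => // V _ Q _.
  by apply: definable_all; logic_in.
- split=> [f fL|g]; last exact: FPT_equiv_PTplus.
  by exists f; split=> //; apply: in_logic_sub PTplus_sub_FPT fL.
- apply: (characterizes_intro (C := fun V => @contains_empty V)).
  + exact: contains_empty_restr.
  + exact: contains_empty_lift.
  + by move=> V f; apply: sat_set0 => H; logic_absurd.
  + by move=> V i Q; apply: definable_contains_empty; logic_in.
- apply: (characterizes_intro
    (C := fun V => [set P | union_closed P /\ @contains_empty V P])).
  + move=> N P [PU0 P0].
    by split; [apply: union_closed_restr|apply: contains_empty_restr].
  + move=> N Q [QU Q0].
    by split; [apply: union_closed_lift|apply: contains_empty_lift].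
  + move=> V f fL; split.
      by apply: union_closed_defined_by fL => H; logic_absurd.
    by apply: sat_set0 fL => H; logic_absurd.
  + by move=> V i Q [QU Q0]; apply: definable_union_closed_set0; logic_in.
- apply: (characterizes_intro (C := fun V => @union_closed V)).
  + exact: union_closed_restr.
  + exact: union_closed_lift.
  + by move=> V f; apply: union_closed_defined_by => H; logic_absurd.
  + by move=> V i Q; apply: definable_union_closed; logic_in.
- apply: (characterizes_intro
    (C := fun V => [set P | downward_closed P /\ @contains_empty V P])).
  + move=> N P [Pd P0].
    by split; [apply: downward_closed_restr|apply: contains_empty_restr].
  + move=> N Q [Qd Q0].
    by split; [apply: downward_closed_lift|apply: contains_empty_lift].
  + move=> V f fL; split.
      by apply: downward_closed_defined_by fL => H; logic_absurd.
    by apply: sat_set0 fL => H; logic_absurd.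
  + by move=> V i Q [Qd Q0]; apply: definable_downward_closed_set0; logic_in.
- apply: (characterizes_intro (C := fun V => @downward_closed V)).
  + exact: downward_closed_restr.
  + exact: downward_closed_lift.
  + by move=> V f; apply: downward_closed_defined_by => H; logic_absurd.
  + by move=> V i Q; apply: definable_downward_closed; logic_in.
Qed.
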